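(* For every pair of positive integers $g,k$, every graph $G_{g,k}$ obtained by the construction described in the context satisfies $\chi(G_{g,k})\ge k$.
   Context: Hypergraph notions. A closed walk of length $\ell$ in a hypergraph $H$ is a sequence $v_0F_0v_1F_1\ldots F_{\ell-1}v_0$ with $v_i,v_{i+1}\in F_i$ for all $0\le i<\ell$ (indices mod $\ell$), $F_i\ne F_{i+1}$ for all $i$ (indices mod $\ell$), and $v_1,\ldots,v_{\ell-1}$ pairwise distinct. An $r$-uniform hypergraph $H$ is tranquil, witnessed by labellings $\lambda=\{\lambda_F\}_{F\in E(H)}$ with $\lambda_F:F\to\{1,\dots,r\}$, if for every closed walk $W=v_0F_0\ldots F_{\ell-1}v_0$ the multigraph on $\{1,\dots,r\}$ with edge multiset $\{\lambda_{F_i}(v_i)\lambda_{F_i}(v_{i+1}):0\le i<\ell\}$ is bridgeless. The chromatic number of a hypergraph is the least number of colours in a vertex colouring with no monochromatic hyperedge; its girth is the length of a shortest Berge cycle (distinct hyperedges $F_1,\dots,F_\ell$ and distinct vertices $x_1,\dots,x_\ell$ with $x_i\in F_i\cap F_{i+1}$, indices mod $\ell$). Construction. Fix a positive integer $g$. $G_{g,1}$ is a single vertex. For $k\ge 2$, given a graph $G_{g,k-1}$ obtained by the construction, with vertex set identified with $\{1,\dots,r\}$, take a finite tranquil $r$-uniform hypergraph $H$ with chromatic number at least $k$ and girth at least $\lceil g/3\rceil$, together with tranquility-witnessing labellings $\lambda_F$, each $\lambda_F:F\to\{1,\dots,r\}$ a bijection. The graph $G_{g,k}$ consists of an independent set $T$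 with a bijection $\nu:T\to V(H)$, together with, for each hyperedge $F\in E(H)$, a disjoint copy $G_F$ of $G_{g,k-1}$; for each $F\in E(H)$ one adds the perfect matching between $G_F$ and $\nu^{-1}(F)$ joining the vertex of $G_F$ corresponding to $i\in\{1,\dots,r\}$ to the vertex $t\in\nu^{-1}(F)$ with $\lambda_F(\nu(t))=i$. No other edges are present. $\chi$ denotes the (vertex) chromatic number of a graph. *)

(* Defs.v *)
From mathcomp Require Import all_boot.
Set Implicit Arguments. Unset Strict Implicit. Unset Printing Implicit Defensive.

(* World: plain MathComp (boot). Indices {1..r} are rendered as 'I_r. *)

Definition graph_colorable (V : finType) (adj : rel V) (c : nat) : Prop :=
  exists f : V -> 'I_c, forall x y, adj x y -> f x != f y.

Definition graph_chi_ge (V : finType) (adj : rel V) (k : nat) : Prop :=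
  forall c, c < k -> ~ graph_colorable adj c.

Definition uniform (W : finType) (E : {set {set W}}) (r : nat) : Prop :=
  forall F, F \in E -> #|F| = r.

Definition monochromatic (W : finType) (c : nat) (f : W -> 'I_c) (F : {set W}) : bool :=
  [forall x in F, forall y in F, f x == f y].

Definition hyp_colorable (W : finType) (E : {set {set W}}) (c : nat) : Prop :=
  exists f : W -> 'I_c, forall F, F \in E -> ~~ monochromatic f F.

Definition hyp_chi_ge (W : finType) (E : {set {set W}}) (k : nat) : Prop :=
  forall c, c < k -> ~ hyp_colorable E c.

Definition berge_cycle (W : finType) (E : {set {set W}}) (l : nat) : Prop :=
  exists (Fs : nat -> {set W}) (xs : nat -> W),
    [/\ forall i, i < l -> Fs i \in E,
        forall i j, i < l -> j < l -> Fs i = Fs j -> i = j,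
        forall i j, i < l -> j < l -> xs i = xs j -> i = j &
        forall i, i < l -> xs i \in Fs i :&: Fs ((i + 1) %% l)].

Definition girth_ge (W : finType) (E : {set {set W}}) (m : nat) : Prop :=
  forall l, 2 <= l -> l < m -> ~ berge_cycle E l.

Definition closed_walk (W : finType) (E : {set {set W}}) (l : nat)
    (v : nat -> W) (F : nat -> {set W}) : Prop :=
  [/\ forall i, i < l -> F i \in E,
      forall i, i < l -> (v i \in F i) && (v ((i + 1) %% l) \in F i),
      forall i, i < l -> F i != F ((i + 1) %% l) &
      forall i j, 0 < i -> i < j -> j < l -> v i != v j].

(* the multigraph on 'I_r with edges a_i b_i (i < l) is bridgeless:
   for every edge i, its endpoints stay connected after deleting edge i *)
Definition bridgeless (r l : nat) (a b : nat -> 'I_r) : Prop :=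
  forall i, i < l ->
    connect (fun x y : 'I_r => [exists j : 'I_l, (val j != i) &&
               (((a j == x) && (b j == y)) || ((a j == y) && (b j == x)))])
            (a i) (b i).

(* tranquility witnessed by the labellings lam F : W -> 'I_r (relevant on F) *)
Definition tranquil (W : finType) (E : {set {set W}}) (r : nat)
    (lam : {set W} -> W -> 'I_r) : Prop :=
  forall l v F, closed_walk E l v F ->
    bridgeless l (fun i => lam (F i) (v i)) (fun i => lam (F i) (v ((i + 1) %% l))).

Definition labelling_bij (W : finType) (E : {set {set W}}) (r : nat)
    (lam : {set W} -> W -> 'I_r) : Prop :=
  forall F, F \in E ->
    {in F &, injective (lam F)} /\ (forall i : 'I_r, exists2 x, x \in F & lam F x = i).

Definition edge_of (W : finType) (E : {set {set W}}) := {F : {set W} | F \in E}.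

Definition step_adj (W T V' : finType) (E : {set {set W}}) (r : nat)
    (nu : T -> W) (lam : {set W} -> W -> 'I_r) (sigma : V' -> 'I_r) (adj' : rel V')
    (x y : (T + (edge_of E * V'))%type) : bool :=
  match x, y with
  | inl _, inl _ => false
  | inl t, inr (F, u) => (nu t \in val F) && (lam (val F) (nu t) == sigma u)
  | inr (F, u), inl t => (nu t \in val F) && (lam (val F) (nu t) == sigma u)
  | inr (F, u), inr (F', u') => (F == F') && adj' u u'
  end.

Inductive constructible (g : nat) : nat -> forall V : finType, rel V -> Prop :=
  | constr_base (V : finType) (adj : rel V) :
      #|V| = 1 -> (forall x y, adj x y = false) -> constructible g 1 adj
  | constr_step (k : nat) (V' : finType) (adj' : rel V') (r : nat)
      (sigma : V' -> 'I_r) (W : finType) (E : {set {set W}})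
      (lam : {set W} -> W -> 'I_r) (T : finType) (nu : T -> W) :
      2 <= k.+1 ->
      constructible g k adj' ->
      bijective sigma ->
      uniform E r ->
      labelling_bij E lam ->
      tranquil E lam ->
      hyp_chi_ge E k.+1 ->
      girth_ge E ((g + 2) %/ 3) ->
      bijective nu ->
      constructible g k.+1 (@step_adj W T V' E r nu lam sigma adj').

(* Main.v *)
Require Import Defs.
From mathcomp Require Import all_boot.

(* Given a proper colouring of G_{g,k+1}
   with at most k colours, pull it back along nu to a colouring of V(H); as
   chi(H) > k some hyperedge F is monochromatic, say with colour a.  Since
   lam_F is onto, every vertex of the copy G_F is matched to a vertex of
   nu^-1(F), so colour a is missing on G_F, which is therefore properly
   coloured with one colour fewer, against chi(G_{g,k}) >= k. *)

Set Implicit Arguments.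
Unset Strict Implicit.
Unset Printing Implicit Defensive.

Lemma graph_colorable_card0 (V : finType) (adj : rel V) (c : nat) :
  #|V| = 0 -> graph_colorable adj c.
Proof.
move=> V0; have noV (x : V) : False by move/card0_eq/(_ x): V0.
by exists (fun x => match noV x with end) => x.
Qed.

Lemma graph_colorable0_card (V : finType) (adj : rel V) :
  graph_colorable adj 0 -> #|V| = 0.
Proof.
move=> [f _]; apply/eqP; rewrite -leqn0 leqNgt.
by apply/negP => /card_gt0P [x _]; case: (f x).
Qed.

Lemma graph_colorable_avoid (V : finType) (adj : rel V) (c : nat)
    (h : V -> 'I_c) (a : 'I_c) :
  (forall x y, adj x y -> h x != h y) -> (forall x, h x != a) ->
  graph_colorable adj c.-1.
Proof.
move=> h_proper h_avoid; have a_h x : a != h x by rewrite eq_sym.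
exists (fun x => s2val (unlift_some (a_h x))) => x y /h_proper; apply: contra.
by move=> /eqP e; rewrite (s2valP (unlift_some (a_h x))) e
  -(s2valP (unlift_some (a_h y))).
Qed.

Lemma monochromatic_eq (W : finType) (c : nat) (f : W -> 'I_c) (F : {set W})
    (x y : W) :
  monochromatic f F -> x \in F -> y \in F -> f x = f y.
Proof.
by move=> /forall_inP mono Fx Fy; apply/eqP; move/forall_inP: (mono x Fx); apply.
Qed.

Lemma hyp_chi_ge_monochromatic (W : finType) (E : {set {set W}}) (k c : nat)
    (f : W -> 'I_c) :
  hyp_chi_ge E k -> c < k -> exists2 F, F \in E & monochromatic f F.
Proof.
move=> chiE c_lt; have [/exists_inP [F FE mono] | no_mono] :=
  boolP [exists F in E, monochromatic f F]; first by exists F.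
case: (chiE c c_lt); exists f => F FE; apply: contra no_mono => mono.
by apply/exists_inP; exists F.
Qed.

Section ConstructionStep.

Variables (W T V' : finType) (E : {set {set W}}) (r : nat).
Variables (nu : T -> W) (nuinv : W -> T) (lam : {set W} -> W -> 'I_r).
Variables (sigma : V' -> 'I_r) (adj' : rel V').
Hypothesis nuK : cancel nuinv nu.
Hypothesis lam_bij : labelling_bij E lam.

Local Notation G := (step_adj nu lam sigma adj').

Lemma step_adj_matched (F : edge_of E) (u : V') :
  exists2 x, x \in val F & G (inl (nuinv x)) (inr (F, u)).
Proof.
have [_ lam_onto] := lam_bij (valP F).
have [x Fx lam_x] := lam_onto (sigma u).
by exists x => //=; rewrite nuK Fx lam_x eqxx.
Qed.

Lemma step_adj_copy (F : edge_of E) (u u' : V') :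
  adj' u u' -> G (inr (F, u)) (inr (F, u')).
Proof. by rewrite /= eqxx. Qed.

Lemma colorable_of_monochromatic_edge (c : nat)
    (f : (T + (edge_of E * V'))%type -> 'I_c) (F : edge_of E) :
  (forall x y, G x y -> f x != f y) ->
  monochromatic (fun w => f (inl (nuinv w))) (val F) ->
  graph_colorable adj' c.-1.
Proof.
move=> f_proper mono.
have [V'0 | /card_gt0P [u0 _]] := posnP #|V'|; first exact: graph_colorable_card0.
have [x0 Fx0 _] := step_adj_matched F u0.
apply: (@graph_colorable_avoid _ _ _ (fun u => f (inr (F, u))) (f (inl (nuinv x0)))).
  by move=> u u' /(step_adj_copy F) /f_proper.
move=> u; have [x Fx /f_proper] := step_adj_matched F u.
by rewrite eq_sym (monochromatic_eq mono Fx Fx0).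
Qed.

End ConstructionStep.

Theorem lemma4p3 (g k : nat) : 0 < g -> 0 < k ->
  forall (V : finType) (adj : rel V), constructible g k adj -> graph_chi_ge adj k.
Proof.
move=> _ _ V adj; elim=> {k V adj}.
  move=> V adj V1 _ [|//] _ /graph_colorable0_card.
  by rewrite V1.
move=> k V' adj' r sigma W E lam T nu k_gt0 _ IH _ _ lam_bij _ chiE _
  [nuinv _ nuK] c c_lt [f f_proper].
have [F FE mono] :=
  hyp_chi_ge_monochromatic (fun w => f (inl (nuinv w))) chiE c_lt.
apply: (IH c.-1); first by case: c c_lt f f_proper mono.
exact: (colorable_of_monochromatic_edge nuK lam_bij (F := exist _ F FE) f_proper).
Qed.
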